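(* Let $S$ be an atomic monoid. (1) For every $s \in S$ we have \[ \omega (S, s) = \sup \bigl\{ |x| \;\big|\; x \in \mathrm{Min} \bigl( \mathsf Z (sS) \bigr) \bigr\} . \] (2) $\omega (S) = \sup \bigl\{ |x| \;\big|\; x \in \mathrm{Min} \bigl( \mathsf Z (uS) \bigr) \text{ for some } u \in \mathcal A (S) \bigr\}$.
   Context: $\mathbb N$ denotes the positive integers, $\mathbb N_0 = \mathbb N\cup\{0\}$; suprema are taken in $\mathbb N_0 \cup \{\infty\}$ (with $\sup\emptyset = 0$). A monoid is a commutative, cancellative semigroup with unit element. $S^\times$ is the group of invertible elements, $\mathcal A(S)$ the set of atoms (irreducible elements), $S_{\mathrm{red}} = \{aS^\times \mid a\in S\}$ the associated reduced monoid. $\mathsf Z(S) = \mathcal F(\mathcal A(S_{\mathrm{red}}))$ is the free abelian monoid with basis $\mathcal A(S_{\mathrm{red}})$, written multiplicatively; $|z|$ is the length of $z\in \mathsf Z(S)$ (number of basis elements counted with multiplicity); $\pi\colon \mathsf Z(S)\to S_{\mathrm{red}}$ is the homomorphism with $\pi(u)=u$ for all $u \in \mathcal A(S_{\mathrm{red}})$. $S$ is atomic if $\pi$ is surjective (every non-unit is a product of atoms). For $S'\subset S$, $\mathsf Z(S') = \{z\in \mathsf Z(S) \mid \pi(z) = aS^\times \text{ for some } a\in S'\}$. For $Z\subset \mathsf Z(S)$, $\mathrm{Min}(Z)$ is the set of elements $x\in Z$ such that $y \in Z$ and $y\mid x$ (in $\mathsf Z(S)$) imply $y=x$. For $b\in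 S$, $\omega(S,b)$ is the smallest $N\in\mathbb N_0\cup\{\infty\}$ with the property: for all $n\in\mathbb N$ and $a_1,\dots,a_n\in S$, if $b\mid a_1\cdots a_n$, then there is a subset $\Omega\subset\{1,\dots,n\}$ with $|\Omega|\le N$ and $b\mid\prod_{\nu\in\Omega}a_\nu$. Moreover $\omega(S)=\sup\{\omega(S,u)\mid u\in\mathcal A(S)\}$. *)

(* Defs.v *)
From HB Require Import structures.
From mathcomp Require Import all_boot all_order.
From mathcomp Require Import finmap multiset.
From mathcomp Require Import boolp classical_sets.

Set Implicit Arguments.
Unset Strict Implicit.
Unset Printing Implicit Defensive.

Local Open Scope classical_set_scope.
Local Open Scope group_scope.

HB.mixin Record Monoid_isComCancel S of monoid.Monoid S := {
  cmulgC : commutative (@mul S);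
  cmulgI : right_injective (@mul S)
}.

#[short(type="cmonoidType")]
HB.structure Definition CMonoid :=
  {S of Monoid_isComCancel S & monoid.Monoid S}.

HB.instance Definition _ (S : cmonoidType) :=
  SemiGroup.isCommutativeLaw.Build S (@mul S) cmulgC.

Section Divisibility.
Variable S : cmonoidType.
Implicit Types a b u : S.

Definition divides a b : Prop := exists c, b = a * c.

Definition units : set S := [set a | exists b, a * b = 1].

Definition atoms : set S :=
  [set u | ~ units u /\ forall a b, u = a * b -> units a \/ units b].

Definition principal a : set S := [set a * b | b in [set: S]].

Definition unit_coset a : set S := [set a * e | e in units].

End Divisibility.
Arguments units : clear implicits.
Arguments atoms : clear implicits.

(* The associated reduced monoid: the set of the cosets a S^x, with the setwise
   product. *)
Definition reduced (S : cmonoidType) : Type := range (@unit_coset S).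
HB.instance Definition _ (S : cmonoidType) := Choice.on (reduced S).

Section Reduced.
Variable S : cmonoidType.
Implicit Types (a b : S) (A B C : reduced S).

Lemma unit_coset_range a : unit_coset a \in range (@unit_coset S).
Proof. by apply/mem_set; exists a. Qed.

Definition red a : reduced S := exist _ (unit_coset a) (unit_coset_range a).

Lemma redP A : exists a, A = red a.
Proof.
by case: A => A HA; have [a _ eA] := set_mem HA; exists a; apply: val_inj.
Qed.

Lemma units1 : units S 1. Proof. by exists 1; rewrite mulg1. Qed.

Lemma unitsM a b : units S a -> units S b -> units S (a * b).
Proof.
move=> [a' aa'] [b' bb']; exists (a' * b').
by rewrite -mulgA (mulgA b) (cmulgC b) -mulgA bb' mulg1.
Qed.

Lemma unit_cosetM a b :
  [set x * y | x in unit_coset a & y in unit_coset b] = unit_coset (a * b).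
Proof.
apply/seteqP; split => [_ [_ [e Ue <-]] [_ [f Uf <-] <-]|_ [e Ue <-]].
  exists (e * f); first exact: unitsM.
  by rewrite -!mulgA; congr (_ * _); rewrite !mulgA (cmulgC b).
exists (a * e); first by exists e.
exists b; first by exists 1; [exact: units1|rewrite mulg1].
by rewrite -!mulgA (cmulgC e).
Qed.

Lemma reduced_mul_range A B :
  [set x * y | x in val A & y in val B] \in range (@unit_coset S).
Proof.
have [a ->] := redP A; have [b ->] := redP B.
by rewrite unit_cosetM unit_coset_range.
Qed.

Definition reduced_mul A B : reduced S :=
  exist (fun X => X \in range (@unit_coset S)) _ (reduced_mul_range A B).

Lemma reduced_mulE a b : reduced_mul (red a) (red b) = red (a * b).
Proof. by apply: val_inj; exact: unit_cosetM. Qed.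

Lemma eq_redP a b : red a = red b <-> exists2 e, units S e & b = a * e.
Proof.
split=> [/(congr1 val)/= eab|[e [f ef] ->]].
  have : unit_coset b b by exists 1; [exact: units1|rewrite mulg1].
  by rewrite -eab => -[e Ue <-]; exists e.
apply: val_inj; apply/seteqP; split => _ [g Ug <-] /=.
  exists (f * g); first by apply: unitsM => //; exists e; rewrite cmulgC.
  by rewrite -mulgA (mulgA e) ef mul1g.
by exists (e * g); [apply: unitsM => //; exists f|rewrite mulgA].
Qed.

Fact reduced_mulA : associative reduced_mul.
Proof.
move=> A B C; have [a ->] := redP A; have [b ->] := redP B.
by have [c ->] := redP C; rewrite !reduced_mulE mulgA.
Qed.

Fact reduced_mulC : commutative reduced_mul.
Proof.
move=> A B; have [a ->] := redP A; have [b ->] := redP B.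
by rewrite !reduced_mulE cmulgC.
Qed.

Fact reduced_mul1 : left_id (red 1) reduced_mul.
Proof. by move=> A; have [a ->] := redP A; rewrite reduced_mulE mul1g. Qed.

Fact reduced_mulr1 : right_id (red 1) reduced_mul.
Proof. by move=> A; rewrite reduced_mulC reduced_mul1. Qed.

Fact reduced_mulI : right_injective reduced_mul.
Proof.
move=> A B C; have [a ->] := redP A; have [b ->] := redP B.
have [c ->] := redP C; rewrite !reduced_mulE => /eq_redP[e Ue].
by rewrite -mulgA => /cmulgI ->; apply/eq_redP; exists e.
Qed.

HB.instance Definition _ := isSemigroup.Build (reduced S) reduced_mulA.
HB.instance Definition _ :=
  Semigroup_isMonoid.Build (reduced S) reduced_mul1 reduced_mulr1.
HB.instance Definition _ :=
  Monoid_isComCancel.Build (reduced S) reduced_mulC reduced_mulI.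

Lemma redM a b : red (a * b) = red a * red b.
Proof. by rewrite -reduced_mulE. Qed.

End Reduced.

(* The free abelian monoid with basis B, written multiplicatively: the product
   is the sum of multisets. *)
Definition free_cmonoid (B : choiceType) : Type := {mset B}%mset.
HB.instance Definition _ (B : choiceType) := Choice.on (free_cmonoid B).

Section FreeMonoid.
Variable B : choiceType.

Fact free_mulI : right_injective (@msetD B).
Proof.
move=> x y z /msetP e; apply/msetP => b.
by have := e b; rewrite !msetE2 => /addnI.
Qed.

HB.instance Definition _ := isSemigroup.Build (free_cmonoid B) (@msetDA B).
HB.instance Definition _ :=
  Semigroup_isMonoid.Build (free_cmonoid B) (@mset0D B) (@msetD0 B).
HB.instance Definition _ :=
  Monoid_isComCancel.Build (free_cmonoid B) (@msetDC B) free_mulI.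

Definition flength (z : free_cmonoid B) : nat := size (enum_mset z).

End FreeMonoid.

Section Factorizations.
Variable S : cmonoidType.

Definition fact_monoid : Type := free_cmonoid (atoms (reduced S)).
HB.instance Definition _ := CMonoid.on fact_monoid.

Definition factor_prod (z : fact_monoid) : reduced S :=
  \prod_(u <- enum_mset z) val u.

Lemma factor_prod1 : factor_prod 1 = 1.
Proof. by rewrite /factor_prod big_mset0. Qed.

Lemma factor_prodM : {morph factor_prod : y z / y * z}.
Proof.
move=> y z; rewrite /factor_prod -big_cat /=; apply: perm_big.
apply/allP => u _ /=.
by rewrite count_cat !count_mem_mset msetE2.
Qed.

Lemma factor_prod_atom (u : atoms (reduced S)) : factor_prod [mset u]%mset = val u.
Proof. by rewrite /factor_prod big_msetn. Qed.

Definition atomic : Prop := forall A : reduced S, exists z, factor_prod z = A.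

Definition factorizations (X : set S) : set fact_monoid :=
  [set z | exists2 a, X a & factor_prod z = red a].

Definition Min (Z : set fact_monoid) : set fact_monoid :=
  [set x | Z x /\ forall y, Z y -> divides y x -> y = x].

End Factorizations.

(* The nonnegative integers extended by oo, which is None. *)
Definition natoo : Type := option nat.
HB.instance Definition _ := Choice.on natoo.

Definition natoo_le (x y : natoo) : bool :=
  match x, y with
  | _, None => true
  | None, Some _ => false
  | Some m, Some n => (m <= n)%N
  end.

Fact natoo_le_refl : reflexive natoo_le.
Proof. by case=> //= n. Qed.

Fact natoo_le_anti : antisymmetric natoo_le.
Proof. by move=> [m|] [n|] //= /anti_leq ->. Qed.

Fact natoo_le_trans : transitive natoo_le.
Proof. by move=> [n|] [m|] [p|] //=; apply: leq_trans. Qed.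

Fact natoo_display : Order.disp_t. Proof. exact: Order.Disp tt tt. Qed.

HB.instance Definition _ := Order.Le_isPOrder.Build natoo_display natoo
  natoo_le_refl natoo_le_anti natoo_le_trans.

Fact natoo_le_total : total (<=%O : rel natoo).
Proof. by move=> [m|] [n|] //=; apply: leq_total. Qed.

HB.instance Definition _ :=
  Order.POrder_isTotal.Build natoo_display natoo natoo_le_total.

Definition fin (n : nat) : natoo := Some n.
Definition infty : natoo := None.

(* The first argument of supremum is its value at the empty set. *)
Definition natoo_sup (X : set natoo) : natoo := supremum (fin 0) X.

Definition natoo_least (X : set natoo) : natoo :=
  xget infty (X `&` lbound X).

Lemma natoo_leastP (X : set natoo) :
  X !=set0 -> (X `&` lbound X) (natoo_least X).
Proof.
move=> [x Xx]; apply: xgetPex.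
have [[n0 Xn0]|Xfin] := pselect (exists n, X (fin n)).
  have ex : exists n, `[< X (fin n) >] by exists n0; apply/asboolP.
  case: (ex_minnP ex) => n /asboolP Xn nmin; exists (fin n); split=> // -[m|] //.
  by move=> Xm; apply: nmin; apply/asboolP.
case: x Xx => [n Xn|Xoo]; first by case: Xfin; exists n.
by exists infty; split=> // -[m Xm|] //; case: Xfin; exists m.
Qed.

Lemma natoo_supP (X : set natoo) : supremums X (natoo_sup X).
Proof.
rewrite /natoo_sup /supremum; case: ifPn => [/eqP ->|_].
  by split=> // -[].
have ub0 : ubound X !=set0 by exists infty => -[].
by apply: xgetPex; exists (natoo_least (ubound X)); exact: natoo_leastP.
Qed.

Section Omega.
Variable S : cmonoidType.

Definition omega_bound (b : S) (N : natoo) : Prop :=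
  forall (n : nat) (a : 'I_n -> S), (0 < n)%N ->
    divides b (\prod_(i < n) a i) ->
    exists2 Omega : {set 'I_n},
      (fin #|Omega| <= N)%O & divides b (\prod_(i in Omega) a i).

Definition omega (b : S) : natoo := natoo_least [set N | omega_bound b N].

Definition omega_monoid : natoo :=
  natoo_sup [set omega u | u in atoms S].

End Omega.
Arguments omega_monoid : clear implicits.

(* Main.v *)
(* The bounds [N] admissible in the definition of [omega s] are exactly the upper
   bounds of the lengths of the minimal [x] with [pi x] in [sS]. If
   [x = u_1 ... u_k] is minimal, then a subproduct of the [u_i] still divisible
   by [s] must be all of [x], so [k <= N]. Conversely, if [s] divides
   [a_1 ... a_n] and [z_i] factors [a_i], then some minimal [x] divides
   [z_1 ... z_n], and in the free monoid [x] already divides a subproduct of at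
   most [|x|] of the [z_i]. *)
Require Import Defs.
From mathcomp Require Import all_boot all_order.
From mathcomp Require Import finmap multiset.
From mathcomp Require Import boolp classical_sets.

Local Open Scope classical_set_scope.

Section Divisibility.
Local Open Scope group_scope.
Context {S : cmonoidType}.
Implicit Types a b c : S.

Lemma divides_trans a b c : divides a b -> divides b c -> divides a c.
Proof. by move=> [d ->] [e ->]; exists (d * e); rewrite mulgA. Qed.

Lemma divides_mul2l c a b : divides a b -> divides (c * a) (c * b).
Proof. by move=> [d ->]; exists d; rewrite mulgA. Qed.

Lemma divides_prod_subset (I : finType) (A B : {set I}) (f : I -> S) :
  A \subset B -> divides (\prod_(i in A) f i) (\prod_(i in B) f i).
Proof.
move=> sAB; exists (\prod_(i in B :\: A) f i).
by rewrite (big_setID A) /= (finset.setIidPr sAB).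
Qed.

(** The unit separating two representatives of a coset is absorbed into the cofactor. This lets
    divisibility in [S] be tested on factorizations, which only see [reduced S]. *)
Lemma divides_red a b : divides (red a) (red b) <-> divides a b.
Proof.
split=> [[C]|[c ->]]; last by exists (red c); rewrite redM.
have [c ->] := redP C; rewrite -redM => /esym/eq_redP[e _ ->].
by exists (c * e); rewrite mulgA.
Qed.

Lemma red_prod (I : Type) (r : seq I) (P : pred I) (f : I -> S) :
  red (\prod_(i <- r | P i) f i) = \prod_(i <- r | P i) red (f i).
Proof. by rewrite (big_morph (@red S) (@redM S) (erefl (red 1))). Qed.

End Divisibility.

Section FreeMonoid.
Local Open Scope group_scope.
Context {B : choiceType}.
Implicit Types (x y z : free_cmonoid B) (u : B).

Definition gen u : free_cmonoid B := [mset u]%mset.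

Lemma flength1 : flength (1 : free_cmonoid B) = 0%N.
Proof. by rewrite /flength enum_mset0. Qed.

Lemma flengthM x y : flength (x * y) = (flength x + flength y)%N.
Proof.
rewrite /flength -size_cat; apply/perm_size/allP => u _ /=.
by rewrite count_cat !count_mem_mset msetE2.
Qed.

Lemma flength_gen u : flength (gen u) = 1%N.
Proof. by rewrite /flength enum_msetn. Qed.

Lemma flength_eq0 x : flength x = 0%N -> x = 1.
Proof.
move=> /size0nil ex; apply/msetP => u.
by rewrite -count_mem_mset ex mset0E.
Qed.

Lemma prod_gen x : \prod_(u <- enum_mset x) gen u = x.
Proof.
apply/msetP => v; rewrite -[in RHS]count_mem_mset.
elim: (enum_mset x) => [|u s IHs]; first by rewrite big_nil mset0E.
by rewrite big_cons msetE2 IHs msetnE /= eq_sym; case: (u == v).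
Qed.

Lemma flength_prod_gen (I : finType) (A : {set I}) (f : I -> B) :
  flength (\prod_(i in A) gen (f i)) = #|A|.
Proof.
rewrite (big_morph _ flengthM flength1) -sum1_card.
by apply: eq_bigr => i _; rewrite flength_gen.
Qed.

Lemma gen_divides u x : (0 < x u)%N -> divides (gen u) x.
Proof.
move=> xu; exists (x `\ u)%mset; apply/esym.
by apply: msetB1K; rewrite -mset_gt0.
Qed.

Lemma flength_gt0_gen x : (0 < flength x)%N -> exists u, divides (gen u) x.
Proof.
rewrite /flength; case ex: (enum_mset x) => [//|u s] _; exists u.
by apply: gen_divides; rewrite -count_mem_mset ex /= eqxx.
Qed.

(** Basis elements are prime: the multiplicity of [u] is additive, so if it is positive in a product
    it is positive in some factor. *)
Lemma gen_divides_prod (I : finType) (z : I -> free_cmonoid B) u :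
  divides (gen u) (\prod_i z i) -> exists i, divides (gen u) (z i).
Proof.
move=> [w ew].
have/(big_morph (fun z : free_cmonoid B => z u)) ez :
  {morph (fun z : free_cmonoid B => z u) : y z / y * z >-> (y + z)%N}.
  by move=> y z'; rewrite msetE2.
have : (0 < \sum_i z i u)%N.
  by rewrite -(ez _ _ (mset0E u)) ew msetE2 msetnxx.
rewrite lt0n sum_nat_eq0 negb_forall => /existsP[i]; rewrite -lt0n => zi.
by exists i; exact: gen_divides.
Qed.

(* Each basis element of [x] is charged to one factor [z j] containing it. *)
Lemma divides_subprod (I : finType) (z : I -> free_cmonoid B) x :
  divides x (\prod_i z i) ->
  exists2 A : {set I}, (#|A| <= flength x)%N & divides x (\prod_(i in A) z i).
Proof.
move ek: (flength x) => k; elim: k x z ek => [|k IHk] x z ek.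
  rewrite (flength_eq0 _ ek) => _; exists finset.set0;
    rewrite ?cards0 ?big_set0 //.
  by exists 1; rewrite mulg1.
have [|u ux] := flength_gt0_gen x; first by rewrite ek.
move=> xz.
have [j [w ew]] := gen_divides_prod _ _ _ (divides_trans _ _ _ ux xz).
(* One copy of [u] is cancelled from [x] and from [z j], which leaves [x'] and the family [z'] for
   the induction. *)
case: ux => x' ex; pose z' i := if i == j then w else z i.
(* The index set is arbitrary because this serves twice: for the full product and for [j |: A]. *)
have zz' (P : pred I) :
    P j -> \prod_(i | P i) z i = gen u * \prod_(i | P i) z' i.
  have z'j : z' j = w by rewrite /z' eqxx.
  move=> Pj; rewrite !(bigD1 j Pj) /= z'j mulgA -ew; congr (_ * _).
  by apply: eq_bigr => i /andP[_ /negPf nij]; rewrite /z' nij.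
have [||A leA x'A] := IHk x' z'.
- by move: ek; rewrite ex flengthM flength_gen add1n => -[].
- by case: xz => c; rewrite ex zz' // -mulgA => /cmulgI->; exists c.
exists (j |: A).
  (* The index [j] may already lie in [A], when [z j] also accounts for part of [x']. *)
  by rewrite cardsU1; case: (j \in A); rewrite ?add0n ?ltnS // ltnW.
rewrite ex (zz' (mem (j |: A))) /= ?setU11 //; apply: divides_mul2l.
apply: divides_trans x'A _; apply: divides_prod_subset.
exact: finset.subsetUr.
Qed.

End FreeMonoid.

Lemma natoo_sup_le (X : set natoo) (N : natoo) :
  (natoo_sup X <= N)%O <-> ubound X N.
Proof.
have [ub lb] := natoo_supP X; split=> [leN n Xn|/lb//].
exact: Order.POrderTheory.le_trans (ub n Xn) leN.
Qed.

(** Links the two forms of the result: [omega] is defined as a least element, the right-hand sides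
    as suprema. *)
Lemma natoo_least_ubound (X : set natoo) : natoo_least (ubound X) = natoo_sup X.
Proof.
have [ub lb] := natoo_supP X.
have [|ub' lb'] := @natoo_leastP (ubound X); first by exists (natoo_sup X).
by apply/Order.POrderTheory.le_anti/andP; split; [exact: lb'|exact: lb].
Qed.

Section Omega.
Local Open Scope group_scope.
Context {S : cmonoidType}.

(** Strong induction on the length: a proper divisor is strictly shorter, since only [1] has length
    0. *)
Lemma Min_divides (Z : set (fact_monoid S)) z :
  Z z -> exists2 x, Min Z x & divides x z.
Proof.
have [k] := ubnP (flength z); elim: k z => // k IHk z; rewrite ltnS => lek Zz.
have [Mz|] := pselect (Min Z z).
  by exists z => //; exists 1; rewrite mulg1.
move=> /not_andP[//|/existsNP[y /not_implyP[Zy /not_implyP[[c ez] nyz]]]].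
have [|//|x Mx xy] := IHk y.
  apply: leq_trans lek; rewrite ez flengthM -addn1 leq_add2l lt0n.
  by apply: contra_not_neq nyz => /flength_eq0 c1; rewrite ez c1 mulg1.
by exists x => //; apply: divides_trans xy _; exists c.
Qed.

Lemma factorizations_principal (s : S) z :
  factorizations (principal s) z <-> divides (red s) (factor_prod z).
Proof.
split=> [[_ [c _ <-] ->]|[C ez]]; first by exists (red c); rewrite redM.
have [c eC] := redP C; exists (s * c); first by exists c.
by rewrite ez eC redM.
Qed.

Lemma factor_prod_prod (I : Type) (r : seq I) (P : pred I)
    (z : I -> fact_monoid S) :
  factor_prod (\prod_(i <- r | P i) z i) =
  \prod_(i <- r | P i) factor_prod (z i).
Proof. by rewrite (big_morph _ (@factor_prodM S) (@factor_prod1 S)). Qed.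

Lemma omega_bound_Min (s : S) (N : natoo) x :
  omega_bound s N -> Min (factorizations (principal s)) x ->
  (fin (flength x) <= N)%O.
Proof.
move=> bN [/factorizations_principal sx minx].
(* [omega_bound] speaks only of nonempty families, so the empty factorization is treated apart. *)
have [x0|x_gt0] := posnP (flength x); first by rewrite x0; case: N {bN}.
pose u i := tnth (in_tuple (enum_mset x)) i.
(* The atoms in [x] are cosets; [omega_bound] must be applied to representatives in [S]. *)
have [a ua] := boolp.choice (fun i => redP (val (u i))).
have eP (P : pred 'I_(flength x)) :
    red (\prod_(i | P i) a i) = factor_prod (\prod_(i | P i) gen (u i)).
  rewrite red_prod factor_prod_prod; apply: eq_bigr => i _.
  by rewrite -ua factor_prod_atom.
have ex : \prod_i gen (u i) = x.
  by rewrite -[RHS]prod_gen [in RHS]big_tnth.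
have [||A leA sA] := bN _ a => //.
  by apply/divides_red; rewrite eP ex.
suff <- : \prod_(i in A) gen (u i) = x by rewrite flength_prod_gen.
apply: minx.
  by apply/factorizations_principal; rewrite -eP; apply/divides_red.
exists (\prod_(i | i \notin A) gen (u i)).
by rewrite -[LHS]ex (bigID (mem A)).
Qed.

Lemma Min_omega_bound (s : S) (N : natoo) : atomic S ->
  (forall x, Min (factorizations (principal s)) x ->
    (fin (flength x) <= N)%O) ->
  omega_bound s N.
Proof.
move=> atomicS minN n a _ /divides_red sa.
have [z za] := boolp.choice (fun i => atomicS (red (a i))).
have eP (P : pred 'I_n) :
    red (\prod_(i | P i) a i) = factor_prod (\prod_(i | P i) z i).
  by rewrite red_prod factor_prod_prod; apply: eq_bigr => i _; rewrite za.
have [|x Mx xz] := Min_divides (factorizations (principal s)) (\prod_i z i).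
  by apply/factorizations_principal; rewrite -eP.
have [A leA [c xA]] := divides_subprod _ _ _ xz.
exists A; first exact: Order.POrderTheory.le_trans (minN _ Mx).
apply/divides_red; rewrite eP xA factor_prodM.
case: Mx => /factorizations_principal sx _.
by apply: divides_trans sx _; exists (factor_prod c).
Qed.

Lemma omega_bound_ubound (s : S) : atomic S ->
  [set N | omega_bound s N] =
  ubound [set fin (flength x) | x in Min (factorizations (principal s))].
Proof.
move=> atomicS; apply/seteqP; split=> N /= bN.
  by move=> _ [x Mx <-]; exact: omega_bound_Min Mx.
by apply: Min_omega_bound => // x Mx; apply: bN; exists x.
Qed.

End Omega.

Theorem proposition3p3 (S : cmonoidType) : atomic S ->
  (forall s : S,
     omega s =
     natoo_sup [set fin (flength x) | x in Min (factorizations (principal s))])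
  /\
  omega_monoid S =
  natoo_sup [set fin (flength x) | x in
    [set x | exists2 u : S, atoms S u & Min (factorizations (principal u)) x]].
Proof.
move=> atomicS.
have omegaE (s : S) : omega s =
    natoo_sup [set fin (flength x) | x in Min (factorizations (principal s))].
  by rewrite /omega omega_bound_ubound // natoo_least_ubound.
(* With both suprema written as least upper bounds, it suffices that the two sets have the same
   upper bounds. *)
split=> //; rewrite /omega_monoid -!natoo_least_ubound; congr natoo_least.
apply/seteqP; split=> N ubN.
  move=> _ [x [u Au Mx] <-].
  have /natoo_sup_le : (natoo_sup [set fin (flength x) | x in
      Min (factorizations (principal u))] <= N)%O.
    by rewrite -omegaE; apply: ubN; exists u.
  by apply; exists x.
move=> _ [u Au <-]; rewrite omegaE; apply/natoo_sup_le => _ [x Mx <-].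
by apply: ubN; exists x => //; exists u.
Qed.
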